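(* Let $A$ and $B$ be two subspaces of $\mathbb{Z}_{p^s}^n$ with $\dim(A)+\dim(B)\leq n$. Then $\dim(A\cap B)=0$ if and only if $\rho\begin{pmatrix}A\\ B\end{pmatrix}=\rho(A)+\rho(B)$. Moreover, $A\cap B=\{0\}$ if and only if $\mathrm{rk}\begin{pmatrix}A\\ B\end{pmatrix}=\rho(A)+\rho(B)$.
   Context: $p$ is a prime, $s\ge1$, $R=\mathbb{Z}_{p^s}$; vectors are row vectors. A set $\{\alpha_1,\dots,\alpha_k\}\subseteq R^n$ is unimodular if the matrix with rows $\alpha_i$ has a right inverse. For a submodule $V\subseteq R^n$, $\dim(V)$ is the largest size of a unimodular subset of $V$. A $k$-subspace is a submodule with a unimodular basis of $k$ vectors; a subspace is identified with a matrix whose rows form such a basis, and $\begin{pmatrix}A\\ B\end{pmatrix}$ stacks representations of $A$ and $B$. Inner rank: $\rho(M)$ is the least $r$ with $M=CD$, $C$ having $r$ columns and $D$ having $r$ rows ($\rho(0)=0$). McCoy rank: with $I_k(M)$ the ideal generated by $k\times k$ minors ($I_0=R$), $\mathrm{rk}(M)=\max\{k:\mathrm{Ann}_R(I_k(M))=(0)\}$. *)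

(* Defs.v *)
From HB Require Import structures.
From mathcomp Require Import all_boot all_order all_algebra.

Set Implicit Arguments.
Unset Strict Implicit.
Unset Printing Implicit Defensive.

Import GRing.Theory.
Local Open Scope ring_scope.

Section Unimodular.

Variables (R : finComNzRingType) (n : nat).

Definition has_right_inverse (k : nat) (M : 'M[R]_(k, n)) : bool :=
  [exists N : 'M[R]_(n, k), M *m N == 1%:M].

Definition rows_mx (S : {set 'rV[R]_n}) : 'M[R]_(#|S|, n) :=
  \matrix_(i < #|S|) (enum_val i : 'rV[R]_n).

Definition unimodular (S : {set 'rV[R]_n}) : bool :=
  has_right_inverse (rows_mx S).

Definition moddim (V : {set 'rV[R]_n}) : nat :=
  \max_(S : {set 'rV[R]_n} | (S \subset V) && unimodular S) #|S|.

Definition is_basis_mx (k : nat) (M : 'M[R]_(k, n)) (V : {set 'rV[R]_n}) :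
    Prop :=
  injective (fun u : 'rV[R]_k => u *m M) /\
  V = [set u *m M | u : 'rV[R]_k].

(* Rows of a matrix with a right inverse are pairwise distinct, so they form a
   unimodular set of exactly k vectors. *)
Definition represents (k : nat) (M : 'M[R]_(k, n)) (V : {set 'rV[R]_n}) :
    Prop :=
  has_right_inverse M /\ is_basis_mx M V.

Definition is_subspace (k : nat) (V : {set 'rV[R]_n}) : Prop :=
  GRing.submod_closed V /\ exists M : 'M[R]_(k, n), represents M V.

End Unimodular.

Section Ranks.

Variables (R : finComNzRingType) (m n : nat).
Implicit Type M : 'M[R]_(m, n).

Definition factors_through M (r : nat) : bool :=
  [exists C : 'M[R]_(m, r), exists D : 'M[R]_(r, n), M == C *m D].

Lemma factors_through_ex M : exists r, factors_through M r.
Proof.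
exists m; apply/existsP; exists 1%:M; apply/existsP; exists M.
by rewrite mul1mx.
Qed.

(* A product through dimension 0 is the zero matrix, so the inner rank of 0
   is 0. *)
Definition inner_rank M : nat := ex_minn (factors_through_ex M).

Definition increasing (k l : nat) (f : {ffun 'I_k -> 'I_l}) : bool :=
  [forall i : 'I_k, forall j : 'I_k, (i < j)%N ==> (f i < f j)%N].

Definition minors (k : nat) M : {set R} :=
  [set \det (mxsub f g M) | f : {ffun 'I_k -> 'I_m} in @increasing k m,
                            g : {ffun 'I_k -> 'I_n} in @increasing k n].

Definition ideal_gen (S : {set R}) : {set R} :=
  [set \sum_(x in S) c x * x | c : {ffun R -> R}].

Definition minor_ideal (k : nat) M : {set R} := ideal_gen (minors k M).

Definition annihilator (I : {set R}) : {set R} :=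
  [set a | [forall x in I, a * x == 0]].

(* There are no k x k minors for k > min(m, n); then the ideal is 0, its
   annihilator is R, and such k never qualify. *)
Definition mccoy_rank M : nat :=
  \max_(k < (minn m n).+1 | annihilator (minor_ideal k M) == [set 0]) k.

End Ranks.

(* Main.v *)
Require Import Defs.
From HB Require Import structures.
From mathcomp Require Import all_boot all_order all_fingroup all_algebra.

(** Write M for the matrix stacking MA above MB, and k for its number of rows.
    A vector of A cap B is the same thing as a row vector u with u M = 0, since
    MA and MB have right inverses; under this correspondence unimodular vectors
    match, so both equivalences become statements about the left kernel of M.

    Divisibility is total in Z/p^s. Hence a k x r matrix C with r < k has a
    unimodular vector in its left kernel, and M = C D passes this vector on to
    M; conversely a unimodular relation between the rows of M eliminates one
    row. So the inner rank of M is k iff no unimodular u satisfies u M = 0.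

    If the left kernel of M vanishes then some k x k minor is a unit: otherwise
    a maximal invertible block of columns shows some row combination with a
    unit coefficient to have only non-unit entries, and multiplying it by
    p^(s-1), which kills every non-unit, gives a nonzero kernel vector.
    Conversely, by the adjugate formula the entries of a kernel vector
    annihilate all k x k minors. *)

Set Implicit Arguments.
Unset Strict Implicit.
Unset Printing Implicit Defensive.

Import GRing.Theory.
Local Open Scope ring_scope.

(** * Sorting injections into increasing maps *)

Lemma increasing_inj k l (f : {ffun 'I_k -> 'I_l}) :
  increasing f -> injective f.
Proof.
move=> /forallP f_incr i j eq_fij; apply: val_inj => /=.
have lt_f (i' j' : 'I_k) : (i' < j')%N -> (f i' < f j')%N.
  by move=> lt_ij; move: (f_incr i') => /forallP/(_ j')/implyP; apply.
by case: (ltngtP i j) => // /lt_f; rewrite eq_fij ltnn.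
Qed.

(** [minors] admits only increasing column choices, so a minor along an arbitrary injection has to
    be sorted; the permutation [t] costs only a sign of the determinant. *)
Lemma increasing_reorder k l (g : 'I_k -> 'I_l) :
  injective g ->
  exists (t : {perm 'I_k}) (h : {ffun 'I_k -> 'I_l}),
    increasing h /\ h =1 g \o t.
Proof.
move=> g_inj; pose gs := [tuple g i | i < k].
pose leT := relpre (@nat_of_ord l) leq.
have /tuple_permP[t def_t] : perm_eq (sort_tuple leT gs) gs by rewrite perm_sort.
exists t, [ffun i => g (t i)]; split; last by move=> i; rewrite ffunE.
apply/forallP=> i; apply/forallP=> j; apply/implyP=> lt_ij; rewrite !ffunE.
have nthE (a : 'I_k) : nth (g i) (sort leT gs) a = g (t a).
  rewrite -[sort leT gs]/(tval (sort_tuple leT gs)) def_t.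
  by rewrite (nth_map a) ?size_enum_ord // nth_ord_enum tnth_mktuple.
have le_ij : leT (g (t i)) (g (t j)).
  have leT_tr : transitive leT by move=> ? ? ? /=; apply: leq_trans.
  have leT_refl : reflexive leT by move=> ? /=; apply: leqnn.
  have sorted_gs : sorted leT (sort leT gs).
    by apply: sort_sorted => ? ?; apply: leq_total.
  rewrite -!nthE; apply: (sorted_leq_nth leT_tr leT_refl (g i) sorted_gs).
  - by rewrite inE size_sort size_tuple.
  - by rewrite inE size_sort size_tuple.
  - exact: ltnW.
rewrite ltn_neqAle; apply/andP; split=> //; apply: contraTneq lt_ij => eq_ij.
by rewrite (perm_inj (g_inj _ _ (val_inj eq_ij))) ltnn.
Qed.

(** * Inner rank, dimension and minors over a finite commutative ring *)

Section FiniteCommutativeRing.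

Variable R : finComNzRingType.

Lemma factors_throughP m n r (M : 'M[R]_(m, n)) :
  reflect (exists C : 'M_(m, r), exists D : 'M_(r, n), M = C *m D)
          (factors_through M r).
Proof.
apply: (iffP existsP) => -[C].
  by case/existsP=> D /eqP; exists C, D.
by case=> D /eqP eqM; exists C; apply/existsP; exists D.
Qed.

Lemma inner_rank_le m n r (M : 'M[R]_(m, n)) (C : 'M_(m, r)) (D : 'M_(r, n)) :
  M = C *m D -> (inner_rank M <= r)%N.
Proof.
move=> eqM; rewrite /inner_rank; case: ex_minnP => r0 _; apply.
by apply/factors_throughP; exists C, D.
Qed.

Lemma inner_rank_factor m n (M : 'M[R]_(m, n)) :
  exists (C : 'M_(m, inner_rank M)) (D : 'M_(inner_rank M, n)), M = C *m D.
Proof. by apply/factors_throughP; rewrite /inner_rank; case: ex_minnP. Qed.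

(** If M = C D and M N = 1 then C (D N) = 1, and an identity matrix cannot factor through a smaller
    size. *)
Lemma inner_rank_right_inverse k n (M : 'M[R]_(k, n)) :
  has_right_inverse M -> inner_rank M = k.
Proof.
case/existsP=> N /eqP MN1; apply/eqP; rewrite eqn_leq.
rewrite (inner_rank_le (esym (mul1mx M))) /=.
have [C [D eqM]] := inner_rank_factor M.
by apply: (@mulmx1_min _ _ _ C (D *m N)); rewrite mulmxA -eqM.
Qed.

(** One vector with a right inverse is already a unimodular set; conversely each member of a
    unimodular set has one, namely a column of the right inverse of the whole. *)
Lemma moddim_eq0 n (V : {set 'rV[R]_n}) :
  moddim V = 0%N <->
  (forall (v : 'rV_n) (w : 'cV_n), v \in V -> v *m w != 1%:M).
Proof.
split=> [dimV v w Vv | noV].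
  apply/eqP=> vw1.
  suff : (#|[set v]| <= moddim V)%N by rewrite cards1 dimV.
  apply: leq_bigmax_cond; rewrite sub1set Vv /=.
  apply/existsP; exists (\matrix_(i, j) w i 0); apply/eqP/matrixP=> i j.
  have -> : i = j.
    by apply: val_inj; case: i j; rewrite cards1 => -[|//] ? [[|//] ?].
  have := congr1 (fun X : 'M_1 => X 0 0) vw1; rewrite !mxE !eqxx => <-.
  apply: eq_bigr => a _; rewrite !mxE.
  by have /set1P-> := enum_valP j.
apply/eqP; rewrite -leqn0; apply/bigmax_leqP=> S /andP[/subsetP sSV].
case/existsP=> N /eqP SN1; rewrite leqNgt; apply/negP=> S_gt0.
pose i := Ordinal S_gt0.
have /eqP[] := noV _ (col i N) (sSV _ (enum_valP i)).
have -> : enum_val i = row i (rows_mx S) by rewrite rowK.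
apply/rowP=> j; rewrite colE mulmxA -row_mul SN1 -colE !mxE.
by rewrite [j]ord1 !eqxx.
Qed.

Lemma row_ann_det k (u : 'rV[R]_k) (M : 'M_k) :
  u *m M = 0 -> forall i, u 0 i * \det M = 0.
Proof.
move=> uM0 i; have := congr1 (mulmx^~ (\adj M)) uM0.
rewrite -mulmxA mul_mx_adj mul0mx mul_mx_scalar => /rowP/(_ i).
by rewrite !mxE mulrC.
Qed.

Lemma mem_minor_ideal m n k (M : 'M[R]_(m, n)) x :
  x \in minors k M -> x \in minor_ideal k M.
Proof.
move=> Mx; apply/imsetP; exists [ffun y => (y == x)%:R] => //.
rewrite (bigD1 x) //= ffunE eqxx mul1r big1 ?addr0 // => y /andP[_ neq_yx].
by rewrite ffunE (negPf neq_yx) mul0r.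
Qed.

Lemma annihilator_minor_ideal m n k (M : 'M[R]_(m, n)) a :
  (a \in annihilator (minor_ideal k M)) =
  [forall x in minors k M, a * x == 0].
Proof.
rewrite inE; apply/forall_inP/forall_inP=> aM0 x.
  by move/mem_minor_ideal/aM0.
case/imsetP=> c _ ->; rewrite mulr_sumr big1 // => y /aM0/eqP ay0.
by rewrite mulrCA ay0 mulr0.
Qed.

Lemma ann_minor_ideal_left_kernel k n (M : 'M[R]_(k, n)) :
  annihilator (minor_ideal k M) = [set 0] ->
  forall u : 'rV_k, u *m M = 0 -> u = 0.
Proof.
move=> annM u uM0; apply/rowP=> i0; rewrite mxE; apply/set1P.
rewrite -annM annihilator_minor_ideal; apply/forall_inP=> x.
case/imset2P=> f g f_incr g_incr ->.
have f_inj : injective f by apply: increasing_inj.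
(* An injective self-map of ['I_k] permutes the rows, so each coordinate of [u] occurs in the
   reindexed [v]. *)
have [f' _ f'K] := injF_bij f_inj; rewrite -[i0]f'K.
pose v := \row_i u 0 (f i).
have -> : u 0 (f (f' i0)) = v 0 (f' i0) by rewrite mxE.
apply/eqP/row_ann_det/rowP=> j; rewrite !mxE.
have /rowP/(_ (g j)) := uM0; rewrite !mxE (reindex_inj f_inj) /= => uMg0.
by rewrite -[RHS]uMg0; apply: eq_bigr => a _; rewrite !mxE.
Qed.

Lemma mccoy_rank_full k n (M : 'M[R]_(k, n)) :
  mccoy_rank M = k -> annihilator (minor_ideal k M) = [set 0].
Proof.
case: (posnP k) M => [-> M _ | k_gt0 M rkM].
  (* Rank 0 is also the value of an empty maximum, so k = 0 is treated apart: the empty minor is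
     1. *)
  apply/eqP; rewrite eqEsubset sub1set; apply/andP; split.
    apply/subsetP=> a; rewrite annihilator_minor_ideal => /forall_inP aM0.
    rewrite inE -[a]mulr1; apply: aM0; apply/imset2P.
    have f_incr l (f : {ffun 'I_0 -> 'I_l}) : increasing f.
      by apply/forallP=> -[].
    exists (finfun (fun i : 'I_0 => i))
           (finfun (fun i : 'I_0 => False_rect 'I_n (notF (ltn_ord i)))).
    - exact: f_incr.
    - exact: f_incr.
    - by rewrite det_mx00.
  by rewrite annihilator_minor_ideal; apply/forall_inP=> x _; rewrite mul0r.
apply/eqP; apply: contra_eqT rkM => annM; rewrite neq_ltn; apply/orP; left.
rewrite -[X in (_ < X)%N](ltn_predK k_gt0) ltnS; apply/bigmax_leqP=> i /eqP ann_i.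
rewrite -ltnS (ltn_predK k_gt0) ltn_neqAle.
rewrite (leq_trans _ (geq_minl k n)) ?andbT -1?ltnS //.
by apply: contraNneq annM => eq_ik; rewrite -[X in minor_ideal X]eq_ik ann_i.
Qed.

End FiniteCommutativeRing.

(** * Rings with total divisibility *)

Section ChainRing.

Variable R : finComUnitRingType.
Hypothesis dvd_total :
  forall x y : R, (exists c, y = c * x) \/ (exists c, x = c * y).

(** If y = c x then x + y = (1 + c) x, so a unit sum makes the divisor x a unit. *)
Lemma chain_local (x y : R) :
  x + y \is a GRing.unit -> (x \is a GRing.unit) || (y \is a GRing.unit).
Proof.
case: (dvd_total x y) => -[c ->].
  by rewrite -{1}[x]mul1r -mulrDl unitrM => /andP[_ ->].
by rewrite -{2}[y]mul1r -mulrDl unitrM => /andP[_ ->]; rewrite orbT.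
Qed.

Lemma chain_sum_unit (I : finType) (F : I -> R) :
  \sum_i F i \is a GRing.unit -> exists i, F i \is a GRing.unit.
Proof.
move=> sum_unit; apply/existsP; move: sum_unit; apply: contraLR.
rewrite negb_exists => /forallP nunit.
apply: (big_ind (fun x : R => x \isn't a GRing.unit)) => [||i _].
- by rewrite unitr0.
- by move=> x y nx ny; apply/negP=> /chain_local; rewrite (negPf nx) (negPf ny).
- exact: nunit.
Qed.

Lemma chain_dvd_min k (x : 'I_k.+1 -> R) :
  exists (i : 'I_k.+1) (c : 'I_k.+1 -> R), forall j, x j = c j * x i.
Proof.
suff [i /fin_all_exists[c xE]] :
    exists i, forall j, exists c, x j = c * x i by exists i, c.
elim: k x => [|k IHk] x.
  by exists 0 => j; exists 1; rewrite mul1r (ord1 j).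
have [i min_i] := IHk (fun j => x (lift 0 j)).
case: (dvd_total (x 0) (x (lift 0 i))) => -[c xE].
  exists 0 => j; case: (unliftP 0 j) => [j' ->|->]; last first.
    by exists 1; rewrite mul1r.
  by have [d ->] := min_i j'; exists (d * c); rewrite xE mulrA.
exists (lift 0 i) => j; case: (unliftP 0 j) => [j' ->|->]; first exact: min_i.
by exists c.
Qed.

(* Gaussian elimination: an entry of the first column divides all the others,
   so the column can be cleared at the cost of one row. *)
Lemma unimodular_left_kernel r k (C : 'M[R]_(k, r)) :
  (r < k)%N ->
  exists (u : 'rV_k) (w : 'cV_k), u *m w = 1%:M /\ u *m C = 0.
Proof.
elim: r k C => [|r IHr] [//|k] C lt_rk.
  exists (delta_mx 0 0), (delta_mx 0 0); split; last by rewrite !thinmx0.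
  by rewrite mul_delta_mx; apply/rowP=> j; rewrite (ord1 j) !mxE.
have [i [c CE]] := chain_dvd_min (fun j => C j 0).
pose c' : 'cV_k := \col_j c (lift i j).
pose T := row' i 1%:M - c' *m row i 1%:M.
have TC : T *m C = row' i C - c' *m row i C.
  by rewrite mulmxBl -mulmxA -row_mul row'Esub mul_rowsub_mx !mul1mx -row'Esub.
(* Dropping column i of the identity gives a right inverse of [T], so a unimodular [u] stays
   unimodular as [u *m T]. *)
have TS : T *m col' i 1%:M = 1%:M.
  rewrite mulmxBl -mulmxA -row_mul row'Esub mul_rowsub_mx !mul1mx.
  apply/matrixP=> a b; rewrite !mxE (inj_eq (@lift_inj _ i)).
  rewrite big1 ?subr0 // => j _.
  by rewrite !mxE (negPf (neq_lift _ _)) mulr0.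
have [u [w [uw1 uC0]]] := IHr k (@rsubmx _ k 1 r (T *m C)) lt_rk.
exists (u *m T), (col' i 1%:M *m w); split.
  by rewrite mulmxA -(mulmxA u) TS mulmx1.
rewrite -mulmxA -[T *m C](@hsubmxK _ k 1 r) (@mul_mx_row _ _ _ 1 r) uC0.
suff -> : @lsubmx _ k 1 r (T *m C) = 0 by rewrite mulmx0 row_mx0.
apply/colP=> j; rewrite TC !mxE big_ord1 !mxE.
have -> : @lshift 1 r 0 = 0 :> 'I_(1 + r) by apply: val_inj.
by rewrite CE subrr.
Qed.

(** Locality gives a unit coordinate u_i. The projection [P] = 1 - u_i^-1 e_i u fixes M because u M
    = 0, and its column i vanishes, so M factors through its rows other than row i. *)
Lemma inner_rank_unimodular_left_kernel k n (M : 'M[R]_(k, n))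
    (u : 'rV_k) (w : 'cV_k) :
  u *m w = 1%:M -> u *m M = 0 -> (inner_rank M < k)%N.
Proof.
move=> uw1 uM0.
have [i ui_unit] : exists i, u 0 i \is a GRing.unit.
  have [|i] := @chain_sum_unit _ (fun i => u 0 i * w i 0).
    by have /matrixP/(_ 0 0) := uw1; rewrite !mxE eqxx => ->; rewrite unitr1.
  by rewrite unitrM => /andP[]; exists i.
pose P := 1%:M - ((u 0 i)^-1 *: delta_mx i 0) *m u.
have PM : P *m M = M by rewrite mulmxBl -mulmxA uM0 mulmx0 mul1mx subr0.
have Pi a : P a i = 0.
  rewrite !mxE big_ord1 !mxE eqxx andbT; case: eqP => _.
    by rewrite mulr1 mulVr // subrr.
  by rewrite mulr0 mul0r subrr.
case: k => [|k] in M u w uw1 uM0 i ui_unit P PM Pi *.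
  by case: i {ui_unit P PM Pi}.
rewrite ltnS; apply: (@inner_rank_le _ _ _ _ _ (col' i P) (row' i M)).
rewrite -{1}PM; apply/matrixP=> a b; rewrite [LHS]mxE (bigD1_ord i) //=.
rewrite Pi mul0r add0r mxE; apply: eq_bigr => j _.
by rewrite [col' i P a j]mxE [row' i M j b]mxE.
Qed.

Lemma inner_rank_full k n (M : 'M[R]_(k, n)) :
  inner_rank M = k <->
  (forall (u : 'rV_k) (w : 'cV_k), u *m M = 0 -> u *m w != 1%:M).
Proof.
split=> [rkM u w uM0 | noU].
  apply/eqP=> uw1; have := inner_rank_unimodular_left_kernel uw1 uM0.
  by rewrite rkM ltnn.
apply/eqP; rewrite eqn_leq (inner_rank_le (esym (mul1mx M))) /= leqNgt.
apply/negP=> lt_rk; have [C [D eqM]] := inner_rank_factor M.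
have [u [w [uw1 uC0]]] := unimodular_left_kernel C lt_rk.
have uM0 : u *m M = 0 by rewrite eqM mulmxA uC0 mul0mx.
by have /eqP[] := noU u w uM0.
Qed.

Variable z : R.
Hypothesis z_neq0 : z != 0.
Hypothesis z_socle : forall x, x \isn't a GRing.unit -> z * x = 0.

(** Induction on the rows: a unit minor of the lower rows is bordered by one more column, or a
    kernel vector appears. The choice [g] may be any function, since a unit determinant forces it to
    be injective. *)
Lemma unit_minor_or_left_kernel k n (M : 'M[R]_(k, n)) :
  (exists g : 'I_k -> 'I_n, \det (colsub g M) \is a GRing.unit) \/
  (exists2 u : 'rV_k, u != 0 & u *m M = 0).
Proof.
elim: k M => [|k IHk] M.
  left; exists (fun i : 'I_0 => False_rect 'I_n (notF (ltn_ord i))).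
  by rewrite det_mx00 unitr1.
rewrite -[k.+1]/(1 + k)%N in M *; rewrite -[M]vsubmxK.
set r := usubmx M; set M0 := dsubmx M.
have [[g0 N0unit]|[u u_neq0 uM0]] := IHk M0; last first.
  right; exists (row_mx 0 u); last by rewrite mul_row_col mul0mx add0r.
  by apply: contraNneq u_neq0; rewrite -row_mx0 => /eq_row_mx[_ ->].
set N0 := colsub g0 M0 in N0unit.
(* The combination [x] of the lower rows agrees with the top row on the columns [g0], so the residue
   [v] vanishes there. *)
pose x := colsub g0 r *m invmx N0.
pose v := r - x *m M0.
have v_g0 : colsub g0 r - x *m N0 = 0 by rewrite mulmxKV ?subrr.
have [/existsP[j vj_unit]|] := boolP [exists j, v 0 j \is a GRing.unit].
  left; exists (fun i : 'I_(1 + k) => if split i is inr i' then g0 i' else j).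
  set N := colsub _ _.
  pose jj := fun _ : 'I_1 => j.
  have NE : N = block_mx (colsub jj r) (colsub g0 r) (colsub jj M0) N0.
    apply/matrixP=> a b; rewrite !mxE.
    by case: (split a) => a'; rewrite !mxE; case: (split b) => b'; rewrite !mxE.
  (* Replacing the top row by [v] is a unitriangular row operation and leaves a block lower
     triangular matrix. *)
  have : \det (block_mx 1%:M (- x) 0 1%:M *m N) = v 0 j * \det N0.
    rewrite NE mulmx_block !mul1mx !mulNmx !mul0mx !add0r v_g0 det_lblock.
    by congr (_ * _); rewrite mulmx_colsub det_mx11 !mxE.
  rewrite det_mulmx det_ublock !det1 !mul1r => ->.
  by rewrite unitrM vj_unit.
rewrite negb_exists => /forallP v_nunit; right.
(* [z] kills every entry of [v], and the first coordinate of this vector is [z] itself, hence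
   nonzero. *)
exists (z *: row_mx 1%:M (- x)).
  apply: contraNneq z_neq0 => /rowP/(_ (lshift k 0)).
  by rewrite mxE row_mxEl !mxE eqxx mulr1 => ->.
rewrite -scalemxAl mul_row_col mul1mx mulNmx -/v.
by apply/rowP=> j; rewrite !mxE -[RHS](z_socle (v_nunit j)) !mxE.
Qed.

Lemma left_kernel_mccoy_rank k n (M : 'M[R]_(k, n)) :
  (forall u : 'rV_k, u *m M = 0 -> u = 0) -> mccoy_rank M = k.
Proof.
move=> kerM.
have [[g Dunit]|[u /eqP u_neq0 /kerM//]] := unit_minor_or_left_kernel M.
have g_inj : injective g.
  move=> i j eq_gij; apply/eqP; apply: contraTT Dunit => neq_ij.
  rewrite -det_tr (determinant_alternate neq_ij) ?unitr0 // => a.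
  by rewrite !mxE eq_gij.
have [t [h [h_incr hE]]] := increasing_reorder g_inj.
have Dh_unit : \det (colsub h M) \is a GRing.unit.
  have -> : colsub h M = col_perm t (colsub g M).
    by apply/matrixP=> i j; rewrite !mxE hE.
  by rewrite col_permE det_mulmx det_perm unitrM Dunit unitrX ?unitrN1.
have le_kn : (k <= n)%N.
  by have := leq_card h (increasing_inj h_incr); rewrite !card_ord.
apply/eqP; rewrite eqn_leq; apply/andP; split.
  apply/bigmax_leqP=> i _.
  by rewrite -ltnS (leq_trans (ltn_ord i)) // ltnS geq_minl.
have lt_k : (k < (minn k n).+1)%N by rewrite (minn_idPl le_kn).
apply: (@leq_bigmax_cond _ _ _ (Ordinal lt_k)) => /=.
rewrite eqEsubset sub1set annihilator_minor_ideal; apply/andP; split; last first.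
  by apply/forall_inP=> x _; rewrite mul0r.
apply/subsetP=> a; rewrite annihilator_minor_ideal => /forall_inP aM0.
rewrite inE -(mulIr_eq0 a (mulIr Dh_unit)); apply: aM0.
apply/imset2P; exists (finfun id) h => //.
  by apply/forallP=> i; apply/forallP=> j; rewrite !ffunE; apply/implyP.
by congr (\det _); apply/matrixP=> i j; rewrite !mxE ffunE.
Qed.

Lemma mccoy_rank_fullP k n (M : 'M[R]_(k, n)) :
  mccoy_rank M = k <-> (forall u : 'rV_k, u *m M = 0 -> u = 0).
Proof.
split; last exact: left_kernel_mccoy_rank.
by move/mccoy_rank_full/ann_minor_ideal_left_kernel.
Qed.

End ChainRing.

(** * The integers modulo p^s *)

Section PrimePower.

Variables p s : nat.
Hypotheses (p_prime : prime p) (s_ge1 : (1 <= s)%N).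

Let ps_gt1 : (1 < p ^ s)%N.
Proof. by rewrite -(exp1n s) ltn_exp2r // prime_gt1. Qed.

Lemma Zps_unit_pfactor (x : 'Z_(p ^ s)) :
  exists (e : nat) (u : 'Z_(p ^ s)), u \is a GRing.unit /\ x = u * p%:R ^+ e.
Proof.
have [x0|x_gt0] := posnP x.
  (* Zero has no valuation; the exponent s serves since p^s = 0 here. *)
  exists s, 1; split; first exact: unitr1.
  by rewrite -natrX pchar_Zp // mulr0 -[x]natr_Zp x0.
have [m pm xE] := pfactor_coprime p_prime x_gt0.
exists (logn p x), m%:R; split; first by rewrite unitZpE // coprimeXl.
by rewrite -natrX -natrM -xE natr_Zp.
Qed.

Lemma Zps_dvd_total (x y : 'Z_(p ^ s)) :
  (exists c, y = c * x) \/ (exists c, x = c * y).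
Proof.
have [e [u [u_unit ->]]] := Zps_unit_pfactor x.
have [f [v [v_unit ->]]] := Zps_unit_pfactor y.
case: (leqP e f) => [le_ef|/ltnW le_fe]; [left|right].
  exists (v * u^-1 * p%:R ^+ (f - e)).
  by rewrite -[in LHS](subnK le_ef) exprD -!mulrA; congr (_ * _);
  rewrite mulrCA mulKr // mulrC.
exists (u * v^-1 * p%:R ^+ (e - f)).
by rewrite -[in LHS](subnK le_fe) exprD -!mulrA; congr (_ * _);
  rewrite mulrCA mulKr // mulrC.
Qed.

Lemma Zps_socle_neq0 : (p%:R ^+ s.-1 : 'Z_(p ^ s)) != 0.
Proof.
rewrite -natrX -val_eqE /= val_Zp_nat // modn_small.
  by rewrite -lt0n expn_gt0 prime_gt0.
by rewrite ltn_exp2l ?prime_gt1 // prednK.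
Qed.

(** A non-unit carries p to an exponent at least 1, which raises the total exponent to at least
    s. *)
Lemma Zps_socle (x : 'Z_(p ^ s)) :
  x \isn't a GRing.unit -> p%:R ^+ s.-1 * x = 0.
Proof.
have [[|e] [u [u_unit ->]]] := Zps_unit_pfactor x; first by rewrite mulr1 u_unit.
move=> _; rewrite mulrCA -exprD addnS -addSn prednK // exprD -natrX pchar_Zp //.
by rewrite mul0r mulr0.
Qed.

End PrimePower.

(** * Intersection of two subspaces as a left kernel *)

Theorem theorem3p4 (p s n : nat) (p_prime : prime p) (s_ge1 : (1 <= s)%N)
    (kA kB : nat) (A B : {set 'rV['Z_(p ^ s)]_n})
    (A_subspace : is_subspace kA A) (B_subspace : is_subspace kB B)
    (MA : 'M['Z_(p ^ s)]_(kA, n)) (MB : 'M['Z_(p ^ s)]_(kB, n))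
    (MA_repr : represents MA A) (MB_repr : represents MB B)
    (dim_le : (moddim A + moddim B <= n)%N) :
  (moddim (A :&: B) = 0%N <->
     inner_rank (col_mx MA MB) = (inner_rank MA + inner_rank MB)%N) /\
  (A :&: B = [set 0] <->
     mccoy_rank (col_mx MA MB) = (inner_rank MA + inner_rank MB)%N).
Proof.
have [MA_inv [injA defA]] := MA_repr; have [MB_inv [injB defB]] := MB_repr.
(* Both right-hand sides become kA + kB, the number of rows of the stack. *)
rewrite (inner_rank_right_inverse MA_inv) (inner_rank_right_inverse MB_inv).
have dvdR := @Zps_dvd_total p s p_prime s_ge1.
case/existsP: MA_inv => NA /eqP MNA; case/existsP: MB_inv => NB /eqP MNB.
have memA a : a *m MA \in A by rewrite defA; apply/imsetP; exists a.
have memB b : b *m MB \in B by rewrite defB; apply/imsetP; exists b.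
have kerE (u : 'rV_(kA + kB)) : u *m col_mx MA MB = 0 ->
    lsubmx u *m MA = - rsubmx u *m MB.
  rewrite -{1}[u]hsubmxK mul_row_col mulNmx => /eqP.
  by rewrite addr_eq0 => /eqP.
have kerI (u : 'rV_(kA + kB)) : u *m col_mx MA MB = 0 ->
    (lsubmx u *m MA \in A :&: B) /\ (rsubmx u *m MB \in A :&: B).
  move=> uM0; have := kerE u uM0 => eqAB; rewrite !inE !memA !memB andbT /=; split.
    by rewrite eqAB memB.
  by rewrite -[rsubmx u]opprK mulNmx -eqAB -mulNmx memA.
have capE v : v \in A :&: B -> exists (a : 'rV_kA) (b : 'rV_kB),
    v = a *m MA /\ row_mx a (- b) *m col_mx MA MB = 0.
  rewrite inE defA defB => /andP[/imsetP[a _ ->] /imsetP[b _ eq_ab]].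
  by exists a, b; split=> //; rewrite mul_row_col mulNmx eq_ab subrr.
have unit_scale k (v : 'rV['Z_(p ^ s)]_k) w :
    (v *m w) 0 0 \is a GRing.unit -> v *m (((v *m w) 0 0)^-1 *: w) = 1%:M.
  move=> vw_unit; rewrite -scalemxAr; apply/rowP=> j.
  by rewrite [j]ord1 mxE mulVr // mxE eqxx.
split.
  apply: (iff_trans (moddim_eq0 _)).
  apply: (iff_trans _ (iff_sym (inner_rank_full dvdR _))); split=> [noV u w uM0 | noU v w].
    have [VA VB] := kerI u uM0; apply/eqP=> uw1.
    (* The unit u w = 1 is the sum of an A-part and a B-part; by locality one of them is a unit, and
       after rescaling, [NA] or [NB] turns its column into a right inverse of a vector of the
       intersection. *)
    have : (lsubmx u *m usubmx w) 0 0 + (rsubmx u *m dsubmx w) 0 0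
             \is a GRing.unit.
      have /matrixP/(_ 0 0) := uw1.
      rewrite -{1}[u]hsubmxK -{1}[w]vsubmxK mul_row_col !mxE eqxx => ->.
      exact: unitr1.
    case/(chain_local dvdR)/orP=> /unit_scale; set w' := _ *: _ => vw1.
      have /eqP[] := noV _ (NA *m w') VA.
      by rewrite mulmxA -(mulmxA _ MA) MNA mulmx1.
    have /eqP[] := noV _ (NB *m w') VB.
    by rewrite mulmxA -(mulmxA _ MB) MNB mulmx1.
  (* The zero block makes the column see only the A-coordinates, where [MA *m w] tests a MA against
     w. *)
  case/capE=> a [b [-> abM0]]; have := noU _ (col_mx (MA *m w) 0) abM0.
  by rewrite mul_row_col mulmx0 addr0 mulmxA.
have socle_neq0 := @Zps_socle_neq0 p s p_prime s_ge1.
have socleP := @Zps_socle p s p_prime s_ge1.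
apply: (iff_trans _ (iff_sym (mccoy_rank_fullP socle_neq0 socleP _))).
split=> [AB0 u uM0 | kerM].
  have [] := kerI u uM0; rewrite AB0 !inE => /eqP uA0 /eqP uB0.
  have lu0 : lsubmx u = 0 by apply: injA; rewrite uA0 mul0mx.
  have ru0 : rsubmx u = 0 by apply: injB; rewrite uB0 mul0mx.
  by rewrite -[LHS]hsubmxK lu0 ru0 row_mx0.
have A0 := memA 0; have B0 := memB 0; rewrite !mul0mx in A0 B0.
apply/eqP; rewrite eqEsubset sub1set inE A0 B0 !andbT.
apply/subsetP=> v /capE[a [b [-> /kerM]]].
by rewrite -row_mx0 => /eq_row_mx[-> _]; rewrite mul0mx inE.
Qed.
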